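(* Let $n\ge 2$ be an integer. Then: (i) $\mathrm{a}_1(P_n\mathbin{\square} P_\infty)=\mathrm{a}'_1(P_n\mathbin{\square} P_\infty)=\mathrm{a}_1(P_\infty\mathbin{\square} P_\infty)=\mathrm{a}'_1(P_\infty\mathbin{\square} P_\infty)=1$; (ii) $\mathrm{b}_1(P_n\mathbin{\square} P_\infty)=\mathrm{b}'_1(P_n\mathbin{\square} P_\infty)=\mathrm{b}_1(P_\infty\mathbin{\square} P_\infty)=\mathrm{b}'_1(P_\infty\mathbin{\square} P_\infty)=2$.
   Context: $P_n$ is the path on $n$ vertices and $P_\infty$ is the two-way infinite path with vertex set $\mathbb{Z}$ and edge set $\{\{i,i+1\}: i\in\mathbb{Z}\}$. The Cartesian product $G\mathbin{\square} F$ has vertex set $V(G)\times V(F)$, with $(x,y)$ and $(x',y')$ adjacent iff either $x=x'$ and $yy'\in E(F)$, or $y=y'$ and $xx'\in E(G)$. For positive integers $a,b$, the $(a,b)$-biased Maker-Breaker domination game on an infinite graph $G$ with finite vertex degrees is played by Dominator and Staller, who move alternately; on each move Dominator selects $a$ unplayed vertices and Staller selects $b$ unplayed vertices. Staller wins if she can claim (at some point of the game) all vertices of the closed neighborhood of some vertex; Dominator wins if he can prevent Staller from claiming a closed neighborhood throughout the game. In the D-game Dominator moves first; in the S-game Staller moves first. For a positive integer $\ell$ the thresholds (minima over positive integers, $\infty$ if the minimum does not exist) are: $\mathrm{a}_\ell(G)$ (resp. $\mathrm{a}'_\ell(G)$) is the minimum $a$ such that Dominator wins the $(a,\ell)$-biased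 D-game (resp. S-game); $\mathrm{b}_\ell(G)$ (resp. $\mathrm{b}'_\ell(G)$) is the minimum $b$ such that Staller wins the $(\ell,b)$-biased D-game (resp. S-game). *)

(* Defs.v *)
From mathcomp Require Import all_boot all_order all_algebra.
From mathcomp Require Import finmap boolp.

Set Implicit Arguments.
Unset Strict Implicit.
Unset Printing Implicit Defensive.

Record graph := Graph {
  vertex :> choiceType;
  adj : rel vertex;
  adj_sym : symmetric adj;
  adj_irr : irreflexive adj }.

Definition path_adj (n : nat) : rel 'I_n :=
  fun i j => (j == i.+1 :> nat) || (i == j.+1 :> nat).

Lemma path_adj_sym n : symmetric (@path_adj n).
Proof. by move=> i j; rewrite /path_adj orbC. Qed.

Lemma path_adj_irr n : irreflexive (@path_adj n).
Proof. by move=> i; rewrite /path_adj orbb ltn_eqF. Qed.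

Definition path_graph (n : nat) : graph :=
  Graph (@path_adj_sym n) (@path_adj_irr n).

Definition zpath_adj : rel int :=
  fun i j => (j == i + 1)%R || (i == j + 1)%R.

Lemma zpath_adj_sym : symmetric zpath_adj.
Proof. by move=> i j; rewrite /zpath_adj orbC. Qed.

Lemma zpath_adj_irr : irreflexive zpath_adj.
Proof.
by move=> i; rewrite /zpath_adj orbb -[X in X == _]GRing.addr0
  (inj_eq (@GRing.addrI _ i)).
Qed.

Definition zpath_graph : graph := Graph zpath_adj_sym zpath_adj_irr.

Definition cart_adj (G F : graph) : rel (G * F)%type :=
  fun p q => ((p.1 == q.1) && adj p.2 q.2) || ((p.2 == q.2) && adj p.1 q.1).

Lemma cart_adj_sym G F : symmetric (@cart_adj G F).
Proof.
move=> p q; rewrite /cart_adj (eq_sym p.1) (eq_sym p.2).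
by rewrite (adj_sym p.1) (adj_sym p.2).
Qed.

Lemma cart_adj_irr G F : irreflexive (@cart_adj G F).
Proof. by move=> p; rewrite /cart_adj !adj_irr !andbF. Qed.

Definition cart_prod (G F : graph) : graph :=
  Graph (@cart_adj_sym G F) (@cart_adj_irr G F).

Notation "G □ F" := (cart_prod G F) (at level 40, left associativity).

Definition closed_nbhd (G : graph) (v : G) : pred G :=
  fun u => (u == v) || adj v u.

Inductive player := Dominator | Staller.

Definition opponent (p : player) : player :=
  if p is Dominator then Staller else Dominator.

Record game := Game {
  board : graph;
  dom_bias : nat;
  stal_bias : nat;
  starter : player }.

Definition bias (g : game) (p : player) : nat :=
  if p is Dominator then dom_bias g else stal_bias g.

(* Moves are numbered from 0, both players' moves together. *)
Definition mover (g : game) (k : nat) : player :=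
  if odd k then opponent (starter g) else starter g.

Definition move (g : game) := {fset board g}.

Definition legal_move (g : game) (h : seq (move g)) (m : move g) : Prop :=
  #|` m| = bias g (mover g (size h)) /\
  (forall m', m' \in h -> [disjoint m' & m]%fset).

Definition legal_history (g : game) (h : seq (move g)) : Prop :=
  forall k, k < size h -> legal_move (take k h) (nth fset0 h k).

Definition legal_play (g : game) (pl : nat -> move g) : Prop :=
  forall k, legal_move (mkseq pl k) (pl k).

Definition strategy (g : game) := seq (move g) -> move g.

(* On an infinite board every legal history has a legal continuation, so this
   condition is satisfiable there and all plays are infinite. *)
Definition legal_strategy (g : game) (p : player) (s : strategy g) : Prop :=
  forall h, legal_history h -> mover g (size h) = p -> legal_move h (s h).

Definition follows (g : game) (p : player) (s : strategy g)
    (pl : nat -> move g) : Prop :=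
  forall k, mover g k = p -> pl k = s (mkseq pl k).

Definition claimed_before (g : game) (p : player) (pl : nat -> move g)
    (k : nat) (u : board g) : Prop :=
  exists i, [/\ i < k, mover g i = p & u \in pl i].

Definition staller_claims (g : game) (pl : nat -> move g) : Prop :=
  exists (k : nat) (v : board g),
    forall u, closed_nbhd v u -> claimed_before Staller pl k u.

Definition won_by (g : game) (p : player) (pl : nat -> move g) : Prop :=
  if p is Staller then staller_claims pl else ~ staller_claims pl.

Definition wins (p : player) (g : game) : Prop :=
  exists s : strategy g, legal_strategy p s /\
    forall pl, legal_play pl -> follows p s pl -> won_by p pl.

(* Minimum over the positive integers; [None] stands for infinity. *)
Definition pos_min (P : nat -> Prop) : option nat :=
  if pselect (exists k, (0 < k) && `[< P k >]) is left e
  then Some (ex_minn e) else None.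

(* Unprimed thresholds: Dominator starts; primed ones: Staller starts. *)
Definition a_thr (l : nat) (G : graph) : option nat :=
  pos_min (fun a => wins Dominator (Game G a l Dominator)).

Definition a_thr' (l : nat) (G : graph) : option nat :=
  pos_min (fun a => wins Dominator (Game G a l Staller)).

Definition b_thr (l : nat) (G : graph) : option nat :=
  pos_min (fun b => wins Staller (Game G l b Dominator)).

Definition b_thr' (l : nat) (G : graph) : option nat :=
  pos_min (fun b => wins Staller (Game G l b Staller)).

(* Main.v *)
(* Part (i) is a pairing strategy: matching (x, 2k) with (x, 2k+1), every closed
   neighbourhood contains a matched pair, of which Staller never gets both.

   For part (ii), Staller with bias 2 plays the box game on many pairwise
   disjoint translates of one closed neighbourhood.  Each round she takes one
   vertex in each of two boxes with [r + 1] missing vertices; Dominator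
   spoils at most one box.  Hence (boxes missing r + 1) + 2 * (boxes missing r)
   never decreases, so 2 ^ (r + 1) boxes missing [r + 1] vertices yield at least
   2 ^ r boxes missing [r], and eventually a completed box. *)
Require Import Defs.
From mathcomp Require Import all_boot all_order all_algebra.
From mathcomp Require Import finmap boolp zify.

Set Implicit Arguments.
Unset Strict Implicit.
Unset Printing Implicit Defensive.

(** * Evaluating minima, and counting in sequences *)

Lemma pos_min1 (P : nat -> Prop) : P 1 -> pos_min P = Some 1.
Proof.
move=> P1; rewrite /pos_min; case: pselect => [e|[]]; last first.
  by exists 1; rewrite /=; apply/asboolP.
case: ex_minnP => m /andP[m0 _] /(_ 1) m1; congr Some; apply/eqP.
by rewrite eqn_leq m0 m1 //; apply/asboolP.
Qed.

Lemma pos_min2 (P : nat -> Prop) : ~ P 1 -> P 2 -> pos_min P = Some 2.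
Proof.
move=> P1 P2; rewrite /pos_min; case: pselect => [e|[]]; last first.
  by exists 2; rewrite /=; apply/asboolP.
case: ex_minnP => m /andP[m0 /asboolP Pm] /(_ 2) m2; congr Some; apply/eqP.
rewrite eqn_leq m2 /=; last exact/asboolP.
by case: m m0 Pm {m2} => [|[|m]].
Qed.

Lemma count_filter_le (T : Type) (P Q : pred T) (s : seq T) :
  count P (filter Q s) <= count P s.
Proof. by rewrite count_filter; apply: sub_count => x /andP[]. Qed.

Lemma count_uniq_le1 (T : eqType) (P : pred T) (s : seq T) :
  uniq s -> (forall x y, P x -> P y -> x = y) -> count P s <= 1.
Proof.
move=> us PP; rewrite -size_filter.
have: all P (filter P s) by exact: filter_all.
have: uniq (filter P s) by exact: filter_uniq.
case: (filter P s) => [|x [|y t]] //=.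
by rewrite inE => /andP[/norP[/eqP xy _] _] /and3P[/PP h /h].
Qed.

(** * Unplayed vertices on an infinite board *)

Section Fresh.
Variables (T : choiceType) (f : nat -> T).
Hypothesis f_inj : injective f.

Lemma fresh_point (Z : {fset T}) : exists x, x \notin Z.
Proof.
apply: contrapT => /forallNP all_in.
have sub : {subset map f (iota 0 #|` Z|.+1) <= Z}.
  by move=> x _; move: (all_in x) => /negP; rewrite negbK.
have := uniq_leq_size _ sub.
by rewrite map_inj_uniq // iota_uniq size_map size_iota ltnn => /(_ isT).
Qed.

Lemma fresh_fset (Z : {fset T}) b :
  exists m : {fset T}, #|` m| = b /\ [disjoint Z & m]%fset.
Proof.
elim: b => [|b [m [mb Zm]]]; first by exists fset0; rewrite cardfs0 fdisjointX0.
have [x] := fresh_point (Z `|` m)%fset; rewrite inE => /norP[xZ xm].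
exists (x |` m)%fset; rewrite cardfsU1 xm mb; split=> //.
by rewrite fdisjoint_sym fdisjointU1X xZ fdisjoint_sym.
Qed.

Lemma fresh_fset_seq (h : seq {fset T}) b :
  exists m : {fset T}, #|` m| = b /\ forall m', m' \in h -> [disjoint m' & m]%fset.
Proof.
have [m [mb Zm]] := fresh_fset (\bigcup_(m' <- h) m')%fset b.
exists m; split=> // m' m'h; apply: fdisjointWl Zm.
exact: bigfcup_sup.
Qed.
End Fresh.

(** * Histories, plays, and incompatibility of winning strategies *)

Section Games.
Variable g : game.
Implicit Types (h : seq (move g)) (m : move g) (pl : nat -> move g).

Lemma mkseq_rcons pl k : mkseq pl k.+1 = rcons (mkseq pl k) (pl k).
Proof. by rewrite /mkseq -addn1 iotaD map_cat cats1. Qed.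

Lemma moverS k : mover g k.+1 = opponent (mover g k).
Proof. by rewrite /mover /=; case: odd; case: starter. Qed.

Lemma take_mkseq pl i k : i <= k -> take i (mkseq pl k) = mkseq pl i.
Proof. by move=> ik; rewrite /mkseq -map_take take_iota (minn_idPl ik). Qed.

Lemma legal_history_mkseq pl k :
  (forall i, i < k -> legal_move (mkseq pl i) (pl i)) ->
  legal_history (mkseq pl k).
Proof.
move=> lpl i; rewrite size_mkseq => ik.
by rewrite take_mkseq ?(ltnW ik) // nth_mkseq //; apply: lpl.
Qed.

Lemma legal_play_disjoint pl i j u :
  legal_play pl -> i < j -> u \in pl i -> u \in pl j -> False.
Proof.
move=> lpl ij ui uj; have [_ /(_ (pl i))] := lpl j.
have -> : pl i \in mkseq pl j by apply/mapP; exists i; rewrite // mem_iota.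
by move=> /(_ isT) /fdisjointP /(_ u ui); rewrite uj.
Qed.

Fixpoint joint_history (sD sS : strategy g) k : seq (move g) :=
  if k is k'.+1 then
    let h := joint_history sD sS k' in
    rcons h (if mover g k' is Dominator then sD h else sS h)
  else [::].

(** Letting the two strategies play against each other yields one legal play that follows both, so
    it would be won by both players. *)
Lemma wins_exclusive : wins Dominator g -> wins Staller g -> False.
Proof.
move=> [sD [legD winD]] [sS [legS winS]].
pose H := joint_history sD sS.
pose pl k := if mover g k is Dominator then sD (H k) else sS (H k).
have plH k : mkseq pl k = H k by elim: k => // k IH; rewrite mkseq_rcons IH.
have leg : legal_play pl.
  (* A strategy is only known to move legally after a legal history, hence the strong induction over
     all earlier moves. *)
  move=> k; elim/ltn_ind: k => k IH.
  have := legal_history_mkseq IH; rewrite plH => hH.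
  have sH : size (H k) = k by rewrite -plH size_mkseq.
  rewrite /pl; case E: (mover g k).
    by apply: legD; rewrite // sH.
  by apply: legS; rewrite // sH.
have fD : follows Dominator sD pl by move=> k E; rewrite plH /pl E.
have fS : follows Staller sS pl by move=> k E; rewrite plH /pl E.
exact: winD pl leg fD (winS pl leg fS).
Qed.

(** A fallback move: [legal_strategy] quantifies over every legal history, including those the
    intended strategy says nothing about. *)
Definition some_legal_move (f : nat -> board g) (f_inj : injective f) h : move g :=
  sval (cid (fresh_fset_seq f_inj h (bias g (mover g (size h))))).

Lemma some_legal_moveP f (f_inj : injective f) h :
  legal_move h (some_legal_move f_inj h).
Proof. by rewrite /some_legal_move; case: cid. Qed.

(** * Wins that Staller can force in boundedly many moves *)

Definition claimed_in h (u : board g) :=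
  exists i, [/\ i < size h, mover g i = Staller & u \in nth fset0 h i].

Lemma claimed_in_rcons h m u : claimed_in h u -> claimed_in (rcons h m) u.
Proof.
move=> [i [ih mi ui]]; exists i; rewrite size_rcons nth_rcons ih.
by split=> //; apply: ltnW.
Qed.

Lemma claimed_in_last h m u :
  mover g (size h) = Staller -> u \in m -> claimed_in (rcons h m) u.
Proof.
by move=> mh um; exists (size h); rewrite size_rcons nth_rcons ltnn eqxx.
Qed.

Definition staller_done h :=
  exists v : board g, forall u, closed_nbhd v u -> claimed_in h u.

(** Here [n] bounds the remaining moves of both players together. The left disjunct allows a win
    before the bound is used up. *)
Fixpoint staller_forces n h : Prop :=
  staller_done h \/
  if n is n'.+1 then
    if mover g (size h) is Staller then
      exists m, legal_move h m /\ staller_forces n' (rcons h m)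
    else forall m, legal_move h m -> staller_forces n' (rcons h m)
  else False.

Lemma staller_forces_leq n n' h :
  n <= n' -> staller_forces n h -> staller_forces n' h.
Proof.
elim: n n' h => [|n IH] [|n'] h //= nn' [dn|F]; try by [left|case: F].
right; move: F; case: mover => [F m lm|[m [lm F]]]; first exact: IH (F m lm).
by exists m; split=> //; apply: IH F.
Qed.

Lemma staller_done_claims pl k : staller_done (mkseq pl k) -> staller_claims pl.
Proof.
move=> [v cv]; exists k, v => u /cv [i []]; rewrite size_mkseq => ik mi.
by rewrite nth_mkseq // => ui; exists i.
Qed.

(** Staller always chooses a move that keeps the win forced within the moves left; when none are
    left, a closed neighbourhood is already hers. *)
Lemma staller_forces_wins (f : nat -> board g) n :
  injective f -> staller_forces n [::] -> wins Staller g.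
Proof.
move=> f_inj F0.
(* A strategy sees only the history, so the number of moves left is recovered as [n - size h];
   playing [m] uses one of them. *)
pose good h m := legal_move h m /\ staller_forces (n - size h).-1 (rcons h m).
pose s h : move g := if pselect (exists m, good h m) is left e then sval (cid e)
                         else some_legal_move f_inj h.
have sP h m : good h m -> good h (s h).
  by move=> gm; rewrite /s; case: pselect => [e|[]]; [case: cid|exists m].
exists s; split.
  move=> h _ _; rewrite /s; case: pselect => [e|_]; first by case: cid => m [].
  exact: some_legal_moveP.
move=> pl leg fol.
suff claims j : forall k, n = k + j -> staller_forces j (mkseq pl k) ->
    staller_claims pl by exact: (claims n 0).
elim: j => [|j IH] k nk /= [] //; try exact: staller_done_claims.
have nkj : (n - k).-1 = j by lia.
rewrite size_mkseq; case E: (mover g k).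
  by move=> F; apply: (IH k.+1); [lia|rewrite mkseq_rcons; apply/F/leg].
move=> [m [lm F]]; apply: (IH k.+1); first by lia.
rewrite mkseq_rcons (fol k E).
have [_] : good (mkseq pl k) (s (mkseq pl k)).
  by apply: (sP _ m); split; rewrite // size_mkseq nkj.
by rewrite size_mkseq nkj.
Qed.

(** * The box game for Staller with bias 2 *)

(* [X] is what Staller still misses of some closed neighbourhood. *)
Definition open_box h r (X : {fset board g}) :=
  [/\ #|` X| = r, (forall m, m \in h -> [disjoint m & X]%fset) &
      exists v : board g, forall u, closed_nbhd v u -> u \in X \/ claimed_in h u].

(* Pairwise disjointness, as a count so that it survives permuting, filtering
   and shrinking the boxes. *)
Definition disjoint_boxes (L : seq {fset board g}) :=
  forall d, count (fun X : {fset board g} => d \in X) L <= 1.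

Lemma open_box_rcons h r X m :
  [disjoint m & X]%fset -> open_box h r X -> open_box (rcons h m) r X.
Proof.
move=> dmX [cX dX [v cv]]; split=> //.
  by move=> m'; rewrite mem_rcons inE => /predU1P[->|/dX].
by exists v => u /cv[|/claimed_in_rcons]; auto.
Qed.

Lemma open_box_shrink h r X m x :
  mover g (size h) = Staller -> x \in X -> x \in m ->
  [disjoint m & X `\ x]%fset -> open_box h r.+1 X ->
  open_box (rcons h m) r (X `\ x)%fset.
Proof.
move=> mh xX xm dm [cX dX [v cv]]; split.
- by move: cX; rewrite (cardfsD1 x) xX => -[].
- move=> m'; rewrite mem_rcons inE => /predU1P[->//|/dX].
  by apply: fdisjointWr; apply: fsubD1set.
- exists v => u /cv[uX|]; last by move=> c; right; apply: claimed_in_rcons.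
  have [->|ux] := eqVneq u x; first by right; apply: claimed_in_last.
  by left; rewrite !inE ux.
Qed.

Lemma open_box0_done h X : open_box h 0 X -> staller_done h.
Proof.
move=> [/eqP]; rewrite cardfs_eq0 => /eqP -> _ [v cv].
by exists v => u /cv[].
Qed.

Hypothesis dom1 : dom_bias g = 1.

(** Dominator's single vertex [d] lies in at most one box of [A ++ C]. Discarding that box lowers
    the weight [size A + 2 * size C] by at most 2. *)
Lemma dominator_step r (A C : seq {fset board g}) h m :
  disjoint_boxes (A ++ C) ->
  {in A, forall X, open_box h r.+1 X} -> {in C, forall X, open_box h r X} ->
  mover g (size h) = Dominator -> legal_move h m ->
  exists A' C', [/\ disjoint_boxes (A' ++ C'),
    {in A', forall X, open_box (rcons h m) r.+1 X},
    {in C', forall X, open_box (rcons h m) r X},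
    size A' <= size A /\ size C' <= size C &
    size A + 2 * size C <= size A' + 2 * size C' + 2].
Proof.
move=> dAC oA oC mh [] /eqP; rewrite mh /= dom1 => /cardfs1P[d ->] dm.
pose Q (X : {fset board g}) := d \in X.
have cd : count Q A + count Q C <= 1 by rewrite -count_cat; apply: dAC.
have oF r' L : {in L, forall X, open_box h r' X} ->
    {in filter (predC Q) L, forall X, open_box (rcons h [fset d]%fset) r' X}.
  move=> oL X; rewrite mem_filter /= => /andP[dX XL].
  by apply: open_box_rcons (oL _ XL); rewrite fdisjoint1X.
exists (filter (predC Q) A), (filter (predC Q) C); split.
- move=> x; apply: leq_trans (dAC x).
  by rewrite -filter_cat; apply: count_filter_le.
- exact: oF.
- exact: oF.
- by rewrite !size_filter !count_size.
- by rewrite !size_filter -(count_predC Q A) -(count_predC Q C); move: cd; lia.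
Qed.

Hypothesis stal2 : stal_bias g = 2.

(** Two boxes of weight 1 leave the first list and return in [C'] with weight 2 each. This gain of 2
    pays for Dominator's next move. *)
Lemma staller_step r X Y (A C : seq {fset board g}) h :
  disjoint_boxes ((X :: Y :: A) ++ C) ->
  {in X :: Y :: A, forall Z, open_box h r.+1 Z} ->
  {in C, forall Z, open_box h r Z} ->
  mover g (size h) = Staller ->
  exists m C', [/\ legal_move h m, disjoint_boxes (A ++ C'),
    {in A, forall Z, open_box (rcons h m) r.+1 Z},
    {in C', forall Z, open_box (rcons h m) r Z} &
    size C' = (size C).+2].
Proof.
move=> dL oA oC mh.
have oX : open_box h r.+1 X by apply: oA; rewrite inE eqxx.
have oY : open_box h r.+1 Y by apply: oA; rewrite !inE eqxx orbT.
have [x xX] : exists x, x \in X.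
  by case: oX => cX _ _; apply/fset0Pn; rewrite -cardfs_gt0 cX.
have [y yY] : exists y, y \in Y.
  by case: oY => cY _ _; apply/fset0Pn; rewrite -cardfs_gt0 cY.
have cx := dL x; have cy := dL y.
rewrite /= xX in cx; rewrite /= yY in cy.
have xY : x \notin Y by move: cx; case: (x \in Y).
have yX : y \notin X by move: cy; case: (y \in X).
have xy : x != y by apply: contraNneq yX => <-.
(* A vertex of [X] or [Y] already exhausts its count of 1, so it lies in no other box. *)
have dXY Z : Z \in A ++ C -> [disjoint [fset x; y] & Z]%fset.
  have out z : z \in (X `|` Y)%fset -> Z \in A ++ C -> z \notin Z.
    rewrite inE => zXY ZL; apply/negP => zZ; move: (dL z) => /=.
    have : 0 < count (fun X : {fset board g} => z \in X) (A ++ C).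
      by rewrite -has_count; apply/hasP; exists Z.
    by case/orP: zXY => ->; lia.
  by move=> ZL; rewrite fdisjointU1X fdisjoint1X !out // inE ?xX ?yY ?orbT.
exists [fset x; y]%fset, [:: X `\ x, Y `\ y & C]%fset; split=> //.
- split; first by rewrite mh /= stal2 cardfs2 xy.
  move=> m' m'h; rewrite fdisjoint_sym fdisjointU1X fdisjoint1X.
  case: oX => _ /(_ m' m'h) /fdisjointP dX _.
  case: oY => _ /(_ m' m'h) /fdisjointP dY _.
  apply/andP; split; first by apply/negP=> /dX; rewrite xX.
  by apply/negP=> /dY; rewrite yY.
- move=> d; move: (dL d); rewrite /= !count_cat /= !inE.
  by case: (d \in X); case: (d \in Y); rewrite ?andbF ?andbT; lia.
- move=> Z ZA; apply: open_box_rcons; first by rewrite dXY // mem_cat ZA.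
  by apply: oA; rewrite !inE ZA !orbT.
- move=> Z; rewrite !inE => /or3P[/eqP->|/eqP->|ZC].
  + apply: open_box_shrink => //; first by rewrite !inE eqxx.
    by rewrite fdisjointU1X fdisjoint1X !inE eqxx /= (negPf yX) andbF.
  + apply: open_box_shrink => //; first by rewrite !inE eqxx orbT.
    by rewrite fdisjointU1X fdisjoint1X !inE eqxx /= (negPf xY) andbF.
  + apply: open_box_rcons (oC _ ZC).
    by rewrite dXY // mem_cat ZC orbT.
Qed.

(* [N] makes the bound on the length of play uniform over Dominator's
   infinitely many replies. *)
Lemma boxes_round r N n :
  (forall (C : seq {fset board g}) h, disjoint_boxes C ->
     {in C, forall X, open_box h r X} -> mover g (size h) = Staller ->
     size C <= N -> 2 ^ r <= size C -> staller_forces n h) ->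
  forall a (A C : seq {fset board g}) h, size A <= a -> disjoint_boxes (A ++ C) ->
  {in A, forall X, open_box h r.+1 X} -> {in C, forall X, open_box h r X} ->
  mover g (size h) = Staller -> size A + size C <= N ->
  2 ^ r.+1 <= size A + 2 * size C ->
  staller_forces (n + 2 * a) h.
Proof.
move=> final; elim=> [|a IHa] A C h Aa dAC oA oC mh AC_N big.
  case: A Aa dAC oA AC_N big => // _ dC _ CN big.
  rewrite muln0 addn0; apply: final dC _ _ _ _ => //.
  by move: big; rewrite expnS /=; lia.
case: A Aa dAC oA AC_N big => [|X [|Y A]] Aa dAC oA AC_N big.
(* With at most one box left in [A], parity turns [2 ^ r.+1 <= size A + 2 * size C] into
   [2 ^ r <= size C]. *)
1,2: apply: (@staller_forces_leq n); first exact: leq_addr.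
1,2: apply: (final C) => //; try by move: AC_N big; rewrite expnS /=; lia.
  by move=> d; move: (dAC d); rewrite /=; lia.
have [m [C' [lm dAC' oA' oC' sC']]] := staller_step dAC oA oC mh.
have mh' : mover g (size (rcons h m)) = Dominator by rewrite size_rcons moverS mh.
(* One unit of [a] pays for Staller's move and Dominator's reply. *)
have -> : n + 2 * a.+1 = (n + 2 * a).+2 by lia.
right; rewrite mh; exists m; split=> //; right; rewrite mh' => m' lm'.
have [A'' [C'' [d'' oA'' oC'' [leA leC] big'']]] :=
  dominator_step dAC' oA' oC' mh' lm'.
move: Aa AC_N big => /= Aa AC_N big.
apply: IHa d'' oA'' oC'' _ _ _; try lia.
by rewrite size_rcons moverS mh'.
Qed.

Lemma boxes_force r N : exists n, forall (A : seq {fset board g}) h,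
  disjoint_boxes A -> {in A, forall X, open_box h r X} ->
  mover g (size h) = Staller -> size A <= N -> 2 ^ r <= size A ->
  staller_forces n h.
Proof.
elim: r => [|r [n IH]].
  exists 0 => -[|X A] h // _ oA _ _ _; left.
  by apply: (@open_box0_done _ X); apply: oA; rewrite inE eqxx.
exists (n + 2 * N) => A h dA oA mh AN big.
by apply: (boxes_round IH (C := [::]) AN) => //=; rewrite ?cats0 ?muln0 ?addn0.
Qed.

Lemma staller_wins_boxes r (f : nat -> board g) :
  injective f ->
  (forall N, exists L : seq {fset board g},
     [/\ size L = N, disjoint_boxes L & {in L, forall X, open_box [::] r X}]) ->
  wins Staller g.
Proof.
move=> f_inj boxes.
suff [n F] : exists n, staller_forces n [::] by exact: staller_forces_wins f_inj F.
(* The surplus over [2 ^ r] absorbs the box that Dominator may spoil when opening the game. *)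
have [L [sL dL oL]] := boxes (2 ^ r).+2.
have [n F] := boxes_force r (size L).
case E: (mover g 0).
  exists n.+1; right; rewrite E => m lm.
  have o0 : {in [::], forall X, open_box [::] r.+1 X} by [].
  have [A [C [dAC _ oC [A0 CL] big]]] := dominator_step (A := [::]) dL o0 oL E lm.
  apply: F oC _ _ _; first by case: (A) A0 dAC.
  - by rewrite /= moverS E.
  - by [].
  - by move: big A0; rewrite sL /=; lia.
by exists n; apply: F => //; rewrite sL; lia.
Qed.

End Games.

(** * The pairing strategy for Dominator *)

Section Pairing.
Variables (G : graph) (mate : G -> G).
Hypothesis mateK : involutive mate.
Hypothesis adj_mate : forall v, adj v (mate v).

(** Claiming the closed neighbourhood of [v] means claiming [v] and [mate v], in two different moves
    as each takes one vertex. Between them Dominator answers the first with its mate. *)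
Lemma pairing_wins (f : nat -> G) (p : player) :
  injective f -> wins Dominator (Game G 1 1 p).
Proof.
move=> f_inj; set g := Game G 1 1 p.
(* On the empty history this is the empty set, which is not a legal move, so an opening Dominator
   uses the fallback. *)
pose reply (h : seq (move g)) : move g := [fset mate u | u in last fset0 h]%fset.
pose s (h : seq (move g)) : move g :=
  if `[< legal_move h (reply h) >] then reply h
  else some_legal_move (g := g) f_inj h.
exists s; split=> [h _ _|pl leg fol [k [v cv]]].
  by rewrite /s; case: asboolP => // _; apply: some_legal_moveP.
have card1 i : #|` pl i| = 1 by have [-> _] := leg i; rewrite /bias; case: mover.
have mate_neq w : mate w != w.
  by apply/eqP => e; have := adj_mate w; rewrite e adj_irr.
suff no_pair i j w : i < j -> mover g i = Staller -> w \in pl i ->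
    mover g j = Staller -> mate w \in pl j -> False.
  have [|i [_ mi vi]] := cv v; first by rewrite /closed_nbhd eqxx.
  have [|j [_ mj vj]] := cv (mate v); first by rewrite /closed_nbhd adj_mate orbT.
  have [ij|ji|ij] := ltngtP i j; first exact: no_pair ij mi vi mj vj.
    by apply: no_pair ji mj vj mi _; rewrite mateK.
  move: vi vj; rewrite -ij; have /eqP/cardfs1P[u ->] := card1 i.
  by rewrite !inE => /eqP -> /eqP e; have := mate_neq u; rewrite e eqxx.
move=> ij mi wi mj mwj.
have pli : pl i = [fset w]%fset.
  have /eqP/cardfs1P[u e] := card1 i.
  by move: wi; rewrite e inE => /eqP ->.
have mi1 : mover g i.+1 = Dominator by rewrite moverS mi.
have replyE : reply (mkseq pl i.+1) = [fset mate w]%fset.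
  by rewrite /reply mkseq_rcons last_rcons pli imfset_fset1.
have ij1 : i.+1 < j.
  by rewrite ltn_neqAle ij andbT; apply/eqP => e; move: mj; rewrite -e mi1.
(* Since Staller takes [mate w] at the later move [j], it is still free at move [i.+1]; the reply is
   therefore legal and is played. *)
have mwi1 : mate w \in pl i.+1.
  rewrite (fol _ mi1) /s; case: asboolP => [_|[]]; first by rewrite replyE inE.
  rewrite replyE; split; first by rewrite size_mkseq mi1 cardfs1.
  move=> m' /mapP[i' ]; rewrite mem_iota => /andP[_ i'i] ->.
  rewrite fdisjointX1; apply/negP => h.
  by apply: (legal_play_disjoint leg _ h mwj); apply: ltn_trans ij1.
exact: legal_play_disjoint leg ij1 mwi1 mwj.
Qed.
End Pairing.

(** * Products with the two-way infinite path *)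

(** Swaps 2k and 2k+1 for every integer k; the parity of [z] is read off its absolute value, also
    for negative [z]. *)
Definition zflip (z : int) : int :=
  (if odd `|z|%N then z - 1 else z + 1)%R.

Lemma zflipK : involutive zflip.
Proof. by rewrite /zflip => z; case: (boolP (odd `|z|%N)) => oz; case: ifP; lia. Qed.

Lemma zpath_adj_flip z : zpath_adj z (zflip z).
Proof. by rewrite /zpath_adj /zflip; case: ifP; lia. Qed.

Section ProductWithPath.
Variable G : graph.
Local Notation GZ := (G □ zpath_graph).
Local Open Scope ring_scope.

Definition zmate (v : GZ) : GZ := (v.1, zflip v.2).

Lemma zmateK : involutive zmate.
Proof. by move=> [x z]; rewrite /zmate /= zflipK. Qed.

Lemma adj_zmate v : adj v (zmate v).
Proof. by rewrite /= /cart_adj eqxx [adj _ _]zpath_adj_flip. Qed.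

Variables (x0 : G) (N : {fset G}).
Hypothesis NP : forall u, closed_nbhd x0 u -> u \in N.

Lemma layer_inj : injective (fun k : nat => (x0, k%:Z) : GZ).
Proof. by move=> i j [] . Qed.

(** A finite set covering the closed neighbourhood of [(x0, 0)]. It may be larger, as [N] need only
    contain the closed neighbourhood of [x0]. *)
Definition box0 : {fset GZ} :=
  ([fset ((u, 0) : GZ) | u in N] `|` [fset ((x0, 1) : GZ); ((x0, -1) : GZ)])%fset.

(** The step 3 separates the translates: [box0] lives in the layers -1, 0 and 1. *)
Definition shift (k : nat) (u : GZ) : GZ := (u.1, u.2 + 3 * k%:Z).

Lemma shift_inj k : injective (shift k).
Proof. by move=> [x z] [y t] [-> /GRing.addIr ->]. Qed.

Definition box k : {fset GZ} := [fset shift k u | u in box0]%fset.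

Lemma box_layer k u : u \in box k -> `|u.2 - 3 * k%:Z| <= 1.
Proof.
case/imfsetP => -[x z] /= + ->; rewrite !inE => /orP[/imfsetP[y _ [_ ->]]|].
  by rewrite /=; lia.
by case/orP => /eqP[_ ->] /=; lia.
Qed.

Lemma closed_nbhd_box k u : closed_nbhd ((x0, 3 * k%:Z) : GZ) u -> u \in box k.
Proof.
case: u => x z adj0; apply/imfsetP; exists ((x, z - 3 * k%:Z) : GZ); last first.
  by rewrite /shift /= GRing.subrK.
move: adj0; rewrite /closed_nbhd /= /cart_adj /= !inE => /orP[/eqP[-> ->]|].
  apply/orP; left; apply/imfsetP; exists x0; rewrite ?GRing.subrr //.
  by apply: NP; rewrite /closed_nbhd eqxx.
case/orP => /andP[/eqP <-].
  rewrite /zpath_adj !xpair_eqE eqxx /= => h; apply/orP; right.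
  by lia.
move=> xx; apply/orP; left; apply/imfsetP; exists x; rewrite ?GRing.subrr //.
by apply: NP; rewrite /closed_nbhd xx orbT.
Qed.

Lemma product_staller_wins p : wins Staller (Game GZ 1 2 p).
Proof.
apply: (@staller_wins_boxes (Game GZ 1 2 p) _ _ #|` box0| _ layer_inj) => // M.
exists (map box (iota 0 M)); split.
- by rewrite size_map size_iota.
- move=> d; rewrite count_map; apply: count_uniq_le1; first exact: iota_uniq.
  by move=> i j /= /box_layer + /box_layer; lia.
- move=> _ /mapP[k _ ->]; split=> //.
    by rewrite card_imfset //; apply: shift_inj.
  by exists (x0, 3 * k%:Z) => u /closed_nbhd_box; left.
Qed.

Lemma product_dominator_wins p : wins Dominator (Game GZ 1 1 p).
Proof. exact: (pairing_wins zmateK adj_zmate p layer_inj). Qed.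

(** Dominator's win with both biases 1 settles the first two values and, by [wins_exclusive], rules
    out 1 for the last two. *)
Lemma product_thresholds :
  [/\ a_thr 1 GZ = Some 1%N, a_thr' 1 GZ = Some 1%N,
      b_thr 1 GZ = Some 2%N & b_thr' 1 GZ = Some 2%N].
Proof.
have lose p : ~ wins Staller (Game GZ 1 1 p).
  exact: wins_exclusive (product_dominator_wins p).
split; first [apply: pos_min1 | apply: pos_min2 => //].
- exact: product_dominator_wins.
- exact: product_dominator_wins.
- exact: product_staller_wins.
- exact: product_staller_wins.
Qed.
End ProductWithPath.

Theorem proposition17 (n : nat) (hn : 2 <= n) :
  [/\ a_thr 1 (path_graph n □ zpath_graph) = Some 1,
      a_thr' 1 (path_graph n □ zpath_graph) = Some 1,
      a_thr 1 (zpath_graph □ zpath_graph) = Some 1 &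
      a_thr' 1 (zpath_graph □ zpath_graph) = Some 1] /\
  [/\ b_thr 1 (path_graph n □ zpath_graph) = Some 2,
      b_thr' 1 (path_graph n □ zpath_graph) = Some 2,
      b_thr 1 (zpath_graph □ zpath_graph) = Some 2 &
      b_thr' 1 (zpath_graph □ zpath_graph) = Some 2].
Proof.
case: n hn => // n' _.
(* The finite set [N] around the chosen vertex is the whole vertex set for the finite path, and {-1,
   0, 1} for the infinite one. *)
have [|a a' b b'] :=
  @product_thresholds (path_graph n'.+1) ord0 [fset u | u in 'I_n'.+1]%fset.
  by move=> u _; rewrite !inE.
have [|c c' d d'] :=
  @product_thresholds zpath_graph 0%R [fset 0; 1; -1]%R%fset.
  by move=> u; rewrite /closed_nbhd /= /zpath_adj !inE; lia.
by [].
Qed.
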